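(* Let $\eta$ be any positive equivalence relation. If there are at least two $\eta$-infinite r.e. sets, then there is an $\eta$-family that is explanatorily learnable but not weakly confidently learnable.
   Context: A positive equivalence relation is an equivalence relation $\eta$ on $\mathbb{N}$ that is recursively enumerable (as a set of pairs) and has infinitely many equivalence classes. A set is $\eta$-closed if it is a union of $\eta$-classes and $\eta$-infinite if it is a union of infinitely many $\eta$-classes. An $\eta$-family is an infinite family of $\eta$-closed sets possessing a uniformly r.e. one-one numbering $B_0,B_1,\dots$ (i.e. $\{\langle k,x\rangle:x\in B_k\}$ is r.e. and $B_i\neq B_j$ for $i\ne j$). $W_0,W_1,\dots$ is a fixed acceptable numbering of the r.e. sets. A text for $L$ is a total $T:\mathbb N\to\mathbb N\cup\{\#\}$ whose range minus $\{\#\}$ is $L$; $T[n]$ is its initial segment of length $n$ and $\mathrm{cnt}(T)$ its range minus $\{\#\}$. A learner is a recursive function $M$ from finite sequences over $\mathbb N\cup\{\#\}$ to $\mathbb N\cup\{?\}$; an output $e$ is interpreted as the hypothesis ''the $\eta$-closure of $W_e$''. $M$ explanatorily learns $\mathcal C$ if on every text $T$ for every $L\in\mathcal C$ it outputs from some point on a single index whose hypothesis equals $L$; $M$ weakly confidently learns $\mathcal C$ if it explanatorily learns $\mathcal C$ and $M(T[n])$ converges on every text $T$ with $\mathrm{cnt}(T)\subseteq L$ for some $L\in\mathcal C$. *)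

(* Defs.v *)
From mathcomp Require Import all_boot.
From mathcomp Require Import boolp classical_sets functions cardinality.
From Stdlib Require Import RelationClasses.

Set Implicit Arguments.
Unset Strict Implicit.
Unset Printing Implicit Defensive.

Local Open Scope classical_set_scope.

(** * Recursive functions and r.e. relations *)

(* The total recursive functions, in Kleene's form: minimization is applied
   only to functions having a zero for all values of the parameters, so that
   no partial function is needed.  [comp], [primrec] and [mu] characterize the
   new function by its defining (in)equations, which determine it pointwise;
   in [mu] the totality of [f] provides the zeros of [g]. *)
Inductive recursive : forall n : nat, (n.-tuple nat -> nat) -> Prop :=
| recursive_zero n : recursive (fun _ : n.-tuple nat => 0)
| recursive_succ : recursive (fun t : 1.-tuple nat => (tnth t ord0).+1)
| recursive_proj n (i : 'I_n) : recursive (fun t : n.-tuple nat => tnth t i)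
| recursive_comp m n (g : m.-tuple nat -> nat)
    (h : 'I_m -> n.-tuple nat -> nat) (f : n.-tuple nat -> nat) :
    recursive g -> (forall i, recursive (h i)) ->
    (forall t, f t = g [tuple h i t | i < m]) ->
    recursive f
| recursive_primrec n (g : n.-tuple nat -> nat) (h : n.+2.-tuple nat -> nat)
    (f : n.+1.-tuple nat -> nat) :
    recursive g -> recursive h ->
    (forall t : n.-tuple nat, f [tuple of 0 :: t] = g t) ->
    (forall (y : nat) (t : n.-tuple nat),
       f [tuple of y.+1 :: t] = h [tuple of y :: f [tuple of y :: t] :: t]) ->
    recursive f
| recursive_mu n (g : n.+1.-tuple nat -> nat) (f : n.-tuple nat -> nat) :
    recursive g ->
    (forall t : n.-tuple nat, g [tuple of f t :: t] = 0) ->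
    (forall (t : n.-tuple nat) (y : nat),
       y < f t -> g [tuple of y :: t] <> 0) ->
    recursive f.

Definition recursive_fun (f : nat -> nat) : Prop :=
  recursive (fun t : 1.-tuple nat => f (tnth t ord0)).

(* R.e. relations are the projections of recursive ones. *)
Definition re (n : nat) (R : set (n.-tuple nat)) : Prop :=
  exists2 g : n.+1.-tuple nat -> nat, recursive g &
    forall t : n.-tuple nat, R t <-> exists y, g [tuple of y :: t] = 0.

Definition re_set (A : set nat) : Prop :=
  re [set t : 1.-tuple nat | A (tnth t ord0)].

Definition re_rel (R : nat -> nat -> Prop) : Prop :=
  re [set t : 2.-tuple nat | R (tnth t ord0) (tnth t ord_max)].

Definition uniformly_re (B : nat -> set nat) : Prop :=
  re_rel (fun k x => B k x).

(* Taking [V] constant shows that an acceptable [W] enumerates every r.e.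
   set. *)
Definition acceptable (W : nat -> set nat) : Prop :=
  uniformly_re W /\
  forall V : nat -> set nat, uniformly_re V ->
    exists2 f : nat -> nat, recursive_fun f & forall k, V k = W (f k).

(** * Positive equivalence relations and families of closed sets *)

Definition eclass (eta : nat -> nat -> Prop) (x : nat) : set nat :=
  [set y | eta x y].

Definition eclasses (eta : nat -> nat -> Prop) : set (set nat) :=
  range (eclass eta).

Definition positive_equivalence (eta : nat -> nat -> Prop) : Prop :=
  [/\ Equivalence eta, re_rel eta & infinite_set (eclasses eta)].

Definition eta_closed (eta : nat -> nat -> Prop) (A : set nat) : Prop :=
  exists2 X : set (set nat), X `<=` eclasses eta & A = \bigcup_(K in X) K.

Definition eta_infinite (eta : nat -> nat -> Prop) (A : set nat) : Prop :=
  exists X : set (set nat),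
    [/\ X `<=` eclasses eta, infinite_set X & A = \bigcup_(K in X) K].

Definition eta_closure (eta : nat -> nat -> Prop) (A : set nat) : set nat :=
  \bigcup_(x in A) eclass eta x.

Definition eta_family (eta : nat -> nat -> Prop) (C : set (set nat)) : Prop :=
  [/\ infinite_set C,
      forall L, C L -> eta_closed eta L &
      exists B : nat -> set nat,
        [/\ uniformly_re B, injective B & range B = C]].

(** * Texts and learners *)

(* [None] is the pause symbol # in data and the answer ? in outputs. *)
Definition content (T : nat -> option nat) : set nat :=
  [set x | exists n, T n = Some x].

Definition is_text (T : nat -> option nat) (L : set nat) : Prop :=
  content T = L.

(* # and ? are coded by 0, a number n by n + 1; [CodeSeq.code] is a
   recursive bijection from sequences of numbers to numbers. *)
Definition symbol_code (a : option nat) : nat := if a is Some x then x.+1 else 0.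

Definition data_code (s : seq (option nat)) : nat :=
  CodeSeq.code (map symbol_code s).

Definition recursive_learner (M : seq (option nat) -> option nat) : Prop :=
  exists2 f : nat -> nat, recursive_fun f &
    forall s, f (data_code s) = symbol_code (M s).

(* [mkseq T n] is the initial segment of [T] of length [n]. *)
Definition converges_to (M : seq (option nat) -> option nat)
    (T : nat -> option nat) (o : option nat) : Prop :=
  exists N, forall n, N <= n -> M (mkseq T n) = o.

Definition explanatorily_learns (W : nat -> set nat) (eta : nat -> nat -> Prop)
    (M : seq (option nat) -> option nat) (C : set (set nat)) : Prop :=
  forall (L : set nat) (T : nat -> option nat), C L -> is_text T L ->
    exists2 e, converges_to M T (Some e) & eta_closure eta (W e) = L.

Definition weakly_confidently_learns (W : nat -> set nat)
    (eta : nat -> nat -> Prop) (M : seq (option nat) -> option nat)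
    (C : set (set nat)) : Prop :=
  explanatorily_learns W eta M C /\
  forall T : nat -> option nat,
    (exists2 L, C L & content T `<=` L) -> exists o, converges_to M T o.

Definition explanatorily_learnable (W : nat -> set nat)
    (eta : nat -> nat -> Prop) (C : set (set nat)) : Prop :=
  exists2 M, recursive_learner M & explanatorily_learns W eta M C.

Definition weakly_confidently_learnable (W : nat -> set nat)
    (eta : nat -> nat -> Prop) (C : set (set nat)) : Prop :=
  exists2 M, recursive_learner M & weakly_confidently_learns W eta M C.

(* Main.v *)
(** Let [A] be an eta-infinite r.e. set missing a point [x0], and let [L n] be
    the eta-closure of the finite set of elements of [A] enumerated by stage
    [n].  The distinct members of the increasing chain [L], together with the
    set of all numbers, form the family.  On a text without [x0], the last
    stage whose elements of [A] have all occurred in the data is nondecreasing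
    and tends to a stage generating the target; once [x0] occurs, the target
    is the set of all numbers.  On the other hand a learner of the members of
    the chain can be fed, one after the other, data from larger and larger
    members, so that it changes its hypothesis infinitely often; and the
    resulting text is contained in a member of the family.  The members of
    the chain are numbered without repetition by counting its jumps, which
    can be approximated from above. *)

Require Import Defs.
From mathcomp Require Import all_boot.
From mathcomp Require Import boolp classical_sets functions cardinality.
From mathcomp Require Import zify.
From Stdlib Require Import RelationClasses.

Set Implicit Arguments.
Unset Strict Implicit.
Unset Printing Implicit Defensive.

Local Open Scope classical_set_scope.

(** * Calculus of recursive functions *)

(* Arguments are read off a sequence, so that [F (x :: t)] needs no cast
   between tuple types. *)
Definition recs (n : nat) (F : seq nat -> nat) : Prop :=
  recursive (fun t : n.-tuple nat => F t).

Lemma eq_recursive n (f g : n.-tuple nat -> nat) :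
  f =1 g -> recursive f -> recursive g.
Proof. by move=> /funext ->. Qed.

Lemma eq_recs n F G :
  (forall t, size t = n -> F t = G t) -> recs n F -> recs n G.
Proof.
by move=> eqFG; apply: eq_recursive => t; apply: eqFG; rewrite size_tuple.
Qed.

Lemma nth_iter_behead k (t : seq nat) i :
  nth 0 (iter k behead t) i = nth 0 t (k + i).
Proof. by elim: k i => [|k IHk] i //=; rewrite nth_behead IHk addnS. Qed.

(** The offset by [iter k behead] lets one statement match, by conversion, arguments read under
    nested bounded operators. Positions past the end give the constant zero. *)
Lemma recs_nth n k i : recs n (fun t => nth 0 (iter k behead t) i).
Proof.
have [lt_n|ge_n] := ltnP (k + i) n; last first.
  apply: (@eq_recs n (fun=> 0)); last exact: recursive_zero.
  by move=> t size_t; rewrite nth_iter_behead nth_default ?size_t.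
apply: eq_recursive (recursive_proj (Ordinal lt_n)) => t.
by rewrite nth_iter_behead (tnth_nth 0).
Qed.

Lemma recs_comp n G (hs : seq (seq nat -> nat)) :
  recs (size hs) G -> (forall i, i < size hs -> recs n (nth (fun=> 0) hs i)) ->
  recs n (fun t => G [seq h t | h <- hs]).
Proof.
move=> recG recH.
apply: (recursive_comp (h := fun i t => nth (fun=> 0) hs i t) recG) => [i|t].
  exact: recH.
congr G; apply: (@eq_from_nth _ 0); rewrite size_map ?size_tuple // => i lti.
rewrite (nth_map (fun=> 0)) //.
set T := [tuple _ | _ < _].
by rewrite -[i]/(nat_of_ord (Ordinal lti)) -tnth_nth tnth_mktuple.
Qed.

Lemma recs_app1 n f a :
  recursive_fun f -> recs n a -> recs n (fun t => f (a t)).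
Proof.
move=> recf reca; apply: (@recs_comp n (fun s => f (nth 0 s 0)) [:: a]).
  by apply: eq_recursive recf => t; rewrite (tnth_nth 0).
by case.
Qed.

Lemma recs_succ n a : recs n a -> recs n (fun t => (a t).+1).
Proof. by apply: recs_app1; apply: recursive_succ. Qed.

Lemma recs_const n c : recs n (fun=> c).
Proof. by elim: c => [|c]; [apply: recursive_zero|apply: recs_succ]. Qed.

Lemma recs_app2 n f a b : recs 2 (fun s => f (nth 0 s 0) (nth 0 s 1)) ->
  recs n a -> recs n b -> recs n (fun t => f (a t) (b t)).
Proof.
move=> recf reca recb.
by apply: (@recs_comp n _ [:: a; b] recf); case=> [|[]].
Qed.

Lemma recs_app3 n f a b c :
  recs 3 (fun s => f (nth 0 s 0) (nth 0 s 1) (nth 0 s 2)) ->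
  recs n a -> recs n b -> recs n c -> recs n (fun t => f (a t) (b t) (c t)).
Proof.
move=> recf reca recb recc.
by apply: (@recs_comp n _ [:: a; b; c] recf); case=> [|[|[]]].
Qed.

Lemma recs_iteri n b g h : recs n b -> recs n g ->
  recs n.+2 (fun s => h (nth 0 s 0) (nth 0 s 1) (behead (behead s))) ->
  recs n (fun t => iteri (b t) (fun y r => h y r t) (g t)).
Proof.
move=> recb recg rech.
pose F s := iteri (nth 0 s 0) (fun y r => h y r (behead s)) (g (behead s)).
have recF : recs n.+1 F by apply: (recursive_primrec recg rech).
(* Primitive recursion has its counter as first argument; [b] is substituted for it, followed by the
   projections that restore [t]. *)
pose hs := b :: [seq (fun t => nth 0 t i) | i <- iota 0 n].
have size_hs : size hs = n.+1 by rewrite /= size_map size_iota.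
have recFb : recs n (fun t => F [seq f t | f <- hs]).
  apply: recs_comp; first by rewrite size_hs.
  case=> [|i] //; rewrite size_hs ltnS => lti.
  rewrite /= (nth_map 0) ?size_iota // nth_iota //.
  exact: (recs_nth n 0).
apply: eq_recs recFb => t size_t.
by rewrite /F /= -map_comp (_ : map _ _ = t) // -[RHS](mkseq_nth 0) size_t.
Qed.

Lemma recs_add n a b : recs n a -> recs n b -> recs n (fun t => a t + b t).
Proof.
move=> reca recb.
apply: (@eq_recs n (fun t => iteri (b t) (fun _ r => r.+1) (a t))).
  by move=> t _; elim: (b t) => [|m /= ->]; rewrite ?addn0 ?addnS.
by apply: recs_iteri => //; apply: recs_succ; apply: (recs_nth _ 0).
Qed.

Lemma recs_mul n a b : recs n a -> recs n b -> recs n (fun t => a t * b t).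
Proof.
move=> reca recb; apply: (@recs_app2 n muln) => //.
apply: (@eq_recs _ (fun s => iteri (nth 0 s 1) (fun _ r => r + nth 0 s 0) 0)).
  by move=> t _; elim: (nth 0 t 1) => [|m /= ->]; rewrite ?muln0 ?mulnSr.
apply: recs_iteri; [exact: (recs_nth _ 0)|exact: recs_const|].
by apply: recs_add; [apply: (recs_nth _ 0)|apply: (recs_nth _ 2)].
Qed.

Lemma recs_exp n a b : recs n a -> recs n b -> recs n (fun t => a t ^ b t).
Proof.
move=> reca recb; apply: (@recs_app2 n expn) => //.
apply: (@eq_recs _ (fun s => iteri (nth 0 s 1) (fun _ r => r * nth 0 s 0) 1)).
  by move=> t _; elim: (nth 0 t 1) => [|m /= ->]; rewrite ?expn0 ?expnSr.
apply: recs_iteri; [exact: (recs_nth _ 0)|exact: recs_const|].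
by apply: recs_mul; [apply: (recs_nth _ 0)|apply: (recs_nth _ 2)].
Qed.

Lemma recs_pred n a : recs n a -> recs n (fun t => (a t).-1).
Proof.
move=> reca; apply: (@eq_recs n (fun t => iteri (a t) (fun y _ => y) 0)).
  by move=> t _; case: (a t).
by apply: recs_iteri; [|apply: recs_const|apply: (recs_nth _ 0)].
Qed.

Lemma recs_sub n a b : recs n a -> recs n b -> recs n (fun t => a t - b t).
Proof.
move=> reca recb.
apply: (@eq_recs n (fun t => iteri (b t) (fun _ r => r.-1) (a t))).
  by move=> t _; elim: (b t) => [|m /= ->]; rewrite ?subn0 ?subnS.
by apply: recs_iteri => //; apply: recs_pred; apply: (recs_nth _ 0).
Qed.

Lemma recs_neg n (P : seq nat -> bool) :
  recs n (fun t => P t) -> recs n (fun t => ~~ P t).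
Proof.
move=> recP; apply: (@eq_recs n (fun t => 1 - P t)).
  by move=> t _; case: (P t).
by apply: recs_sub => //; apply: recs_const.
Qed.

Lemma recs_and n (P Q : seq nat -> bool) :
  recs n (fun t => P t) -> recs n (fun t => Q t) ->
  recs n (fun t => P t && Q t).
Proof.
move=> recP recQ; apply: (@eq_recs n (fun t => P t * Q t)).
  by move=> t _; rewrite mulnb.
exact: recs_mul.
Qed.

Lemma recs_or n (P Q : seq nat -> bool) :
  recs n (fun t => P t) -> recs n (fun t => Q t) ->
  recs n (fun t => P t || Q t).
Proof.
move=> recP recQ; apply: (@eq_recs n (fun t => ~~ (~~ P t && ~~ Q t))).
  by move=> t _; rewrite negb_and !negbK.
by apply: recs_neg; apply: recs_and; apply: recs_neg.
Qed.

Lemma recs_imply n (P Q : seq nat -> bool) :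
  recs n (fun t => P t) -> recs n (fun t => Q t) ->
  recs n (fun t => P t ==> Q t).
Proof.
move=> recP recQ; apply: (@eq_recs n (fun t => ~~ P t || Q t)).
  by move=> t _; rewrite implybE.
by apply: recs_or => //; apply: recs_neg.
Qed.

Lemma recs_leq n a b : recs n a -> recs n b -> recs n (fun t => a t <= b t).
Proof.
move=> reca recb; apply: (@eq_recs n (fun t => 1 - (a t - b t))).
  by move=> t _; rewrite /leq; case: (a t - b t).
by apply: recs_sub; [apply: recs_const|apply: recs_sub].
Qed.

Lemma recs_eq n (a b : seq nat -> nat) :
  recs n a -> recs n b -> recs n (fun t => a t == b t).
Proof.
move=> reca recb; apply: (@eq_recs n (fun t => (a t <= b t) && (b t <= a t))).
  by move=> t _; rewrite eqn_leq.
by apply: recs_and; apply: recs_leq.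
Qed.

Lemma recs_if n (P : seq nat -> bool) a b :
  recs n (fun t => P t) -> recs n a -> recs n b ->
  recs n (fun t => if P t then a t else b t).
Proof.
move=> recP reca recb.
apply: (@eq_recs n (fun t => P t * a t + ~~ P t * b t)).
  by move=> t _; case: (P t); rewrite ?mul1n ?mul0n ?addn0.
by apply: recs_add; apply: recs_mul => //; apply: recs_neg.
Qed.

(** The body of an iteration receives counter, accumulator and parameters; dropping the accumulator
    adapts a predicate of the other two to it. *)
Lemma recs_skip n F : recs n.+1 F ->
  recs n.+2 (fun s => F (nth 0 s 0 :: behead (behead s))).
Proof.
move=> recF.
pose hs := (fun s => nth 0 s 0) :: [seq (fun s => nth 0 s i.+2) | i <- iota 0 n].
have size_hs : size hs = n.+1 by rewrite /= size_map size_iota.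
apply: (@eq_recs _ (fun s => F [seq f s | f <- hs])).
  move=> s size_s /=; rewrite -map_comp; congr (F (_ :: _)).
  rewrite -[RHS](mkseq_nth 0) !size_behead size_s /=.
  by apply: eq_map => i /=; rewrite !nth_behead.
apply: recs_comp; first by rewrite size_hs.
case=> [|i]; rewrite size_hs ltnS => lti; first exact: (recs_nth _ 0).
by rewrite /= (nth_map 0) ?size_iota //; apply: (recs_nth _ 0).
Qed.

Lemma recs_count n (P : nat -> seq nat -> bool) b : recs n b ->
  recs n.+1 (fun s => P (nth 0 s 0) (behead s)) ->
  recs n (fun t => count (fun i => P i t) (iota 0 (b t))).
Proof.
move=> recb recP.
apply: (@eq_recs n (fun t => iteri (b t) (fun y r => r + P y t) 0)).
  move=> t _; elim: (b t) => // m IHm.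
  by rewrite -[in RHS](addn1 m) iotaD count_cat /= IHm addn0.
apply: recs_iteri => //; first exact: recs_const.
apply: recs_add; first exact: (recs_nth _ 0).
exact: (recs_skip recP).
Qed.

Lemma recs_has n (P : nat -> seq nat -> bool) b : recs n b ->
  recs n.+1 (fun s => P (nth 0 s 0) (behead s)) ->
  recs n (fun t => has (fun i => P i t) (iota 0 (b t))).
Proof.
move=> recb recP.
apply: (@eq_recs n (fun t => 0 < count (fun i => P i t) (iota 0 (b t)))).
  by move=> t _; rewrite has_count.
by apply: recs_leq; [apply: recs_const|apply: recs_count].
Qed.

Lemma recs_all n (P : nat -> seq nat -> bool) b : recs n b ->
  recs n.+1 (fun s => P (nth 0 s 0) (behead s)) ->
  recs n (fun t => all (fun i => P i t) (iota 0 (b t))).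
Proof.
move=> recb recP.
apply: (@eq_recs n (fun t => count (fun i => P i t) (iota 0 (b t)) == b t)).
  by move=> t _; rewrite all_count size_iota.
by apply: recs_eq => //; apply: recs_count.
Qed.

Ltac recs_auto := repeat first
  [ assumption
  | exact: (@recs_nth _ 0 _) | exact: (@recs_nth _ 1 _)
  | exact: (@recs_nth _ 2 _) | exact: (@recs_nth _ 3 _)
  | exact: (@recs_nth _ 4 _) | exact: recs_const
  | apply: recs_has | apply: recs_all | apply: recs_count
  | apply: recs_neg | apply: recs_and | apply: recs_or | apply: recs_imply
  | apply: recs_eq | apply: recs_leq
  | apply: recs_exp | apply: recs_mul | apply: recs_add | apply: recs_sub
  | apply: recs_succ | apply: recs_pred ].

Lemma recs_recursive_fun f : recs 1 (fun s => f (nth 0 s 0)) -> recursive_fun f.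
Proof.
by apply: eq_recursive => t; rewrite (tnth_nth 0).
Qed.

Lemma mem_iota0 n i : (i \in iota 0 n) = (i < n).
Proof. by rewrite mem_iota add0n. Qed.

(** * Recursively enumerable relations by stages *)

(** Witnesses are searched below the stage, which keeps the predicate recursive and makes it
    monotone. *)
Lemma re_stages n (R : set (n.-tuple nat)) : re R ->
  exists P : nat -> seq nat -> bool,
    [/\ recs n.+1 (fun s => P (nth 0 s 0) (behead s)),
        forall t : n.-tuple nat, R t <-> exists s, P s t
      & forall s s' t, s <= s' -> P s t -> P s' t].
Proof.
case=> g recg gP.
pose G s := g [tuple nth 0 s i | i < n.+1].
have GE (u : n.+1.-tuple nat) : G u = g u.
  by congr g; apply: eq_from_tnth => i; rewrite tnth_mktuple (tnth_nth 0).
have recG : recs n.+1 G by apply: eq_recursive recg.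
exists (fun s t => has (fun y => G (y :: t) == 0) (iota 0 s)); split.
- apply: (@recs_has _ (fun y s => G (y :: behead s) == 0)).
    exact: (recs_nth _ 0).
  apply: recs_eq; last exact: recs_const.
  exact: recs_skip.
- move=> t; rewrite gP; split=> [[y gy0]|[s /hasP[y _ /eqP gy0]]].
    exists y.+1; apply/hasP; exists y; first by rewrite mem_iota0.
    by rewrite (GE [tuple of y :: t]) gy0.
  by exists y; rewrite -(GE [tuple of y :: t]).
- move=> s s' t les /hasP[y]; rewrite mem_iota0 => lty Gy.
  by apply/hasP; exists y => //; rewrite mem_iota0 (leq_trans lty).
Qed.

(** The conjunct [x < s] makes every stage finite with an explicit bound, so that later quantifiers
    over a stage become bounded searches. *)
Lemma re_set_stages (A : set nat) : re_set A ->
  exists a : nat -> nat -> bool,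
    [/\ recs 2 (fun s => a (nth 0 s 0) (nth 0 s 1)),
        forall x, A x <-> exists s, a s x,
        forall s s' x, s <= s' -> a s x -> a s' x
      & forall s x, a s x -> x < s].
Proof.
case/re_stages=> P [recP RP monoP].
exists (fun s x => (x < s) && P s [:: x]); split.
- apply: recs_and; first by recs_auto.
  by apply: eq_recs recP => -[|x [|y []]].
- move=> x; have := RP [tuple x]; rewrite /= => ->.
  split=> [[s Psx]|[s /andP[_ Psx]]]; last by exists s.
  exists (maxn s x.+1); rewrite leq_maxr.
  by apply: monoP Psx; rewrite leq_maxl.
- move=> s s' x les /andP[ltx Psx].
  by rewrite (leq_trans ltx les) (monoP _ _ _ les Psx).
- by move=> s x /andP[].
Qed.

Lemma re_rel_stages (E : nat -> nat -> Prop) : re_rel E ->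
  exists e : nat -> nat -> nat -> bool,
    [/\ recs 3 (fun s => e (nth 0 s 0) (nth 0 s 1) (nth 0 s 2)),
        forall x y, E x y <-> exists s, e s x y
      & forall s s' x y, s <= s' -> e s x y -> e s' x y].
Proof.
case/re_stages=> P [recP RP monoP].
exists (fun s x y => P s [:: x; y]); split=> [|x y|s s' x y les].
- by apply: eq_recs recP => -[|x [|y [|z []]]].
- exact: (RP [tuple x; y]).
- exact: monoP.
Qed.

Lemma re_rel_of_stages (E : nat -> nat -> Prop) (e : nat -> nat -> nat -> bool) :
  recs 3 (fun s => e (nth 0 s 0) (nth 0 s 1) (nth 0 s 2)) ->
  (forall x y, E x y <-> exists s, e s x y) -> re_rel E.
Proof.
move=> rece EP.
(* [re] looks for zeros, so negation turns truth into zero. *)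
exists (fun t : 3.-tuple nat => ~~ e (nth 0 t 0) (nth 0 t 1) (nth 0 t 2) : nat).
  exact: (recs_neg rece).
move=> t; rewrite /= EP !(tnth_nth 0) /=.
by split=> -[s es]; exists s; [rewrite es|move: es; case: (e _ _ _)].
Qed.

(** * Membership in coded sequences *)

(** In binary, [2 * m + 1] shifted right by [j] ends in a one, [v] zeros and a one. Two inequalities
    replace the division, and neither [j] nor [q] can exceed [2 * m + 1]. *)
Definition code_mem (m v : nat) : bool :=
  has (fun j => has (fun q =>
      (((2 * q + 1) * 2 ^ v.+1 + 1) * 2 ^ j <= 2 * m + 1) &&
      (2 * m + 1 < ((2 * q + 1) * 2 ^ v.+1 + 1).+1 * 2 ^ j))
    (iota 0 (2 * m + 2))) (iota 0 (2 * m + 2)).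

Lemma recs_code_mem : recs 2 (fun s => code_mem (nth 0 s 0) (nth 0 s 1)).
Proof. by rewrite /code_mem; recs_auto. Qed.

Lemma code_memP m v : reflect
  (exists j q, (2 * m + 1) %/ 2 ^ j = (2 * q + 1) * 2 ^ v.+1 + 1)
  (code_mem m v).
Proof.
apply: (iffP hasP) => [[j _ /hasP[q _ /andP[le_u lt_u]]]|[j [q def_q]]].
  exists j, q; apply/eqP; rewrite eqn_leq leq_divRL ?expn_gt0 // le_u andbT.
  by rewrite -ltnS ltn_divLR ?expn_gt0.
have le_X : ((2 * q + 1) * 2 ^ v.+1 + 1) * 2 ^ j <= 2 * m + 1.
  by rewrite -def_q leq_trunc_div.
exists j.
  rewrite mem_iota0 addnS ltnS; apply: leq_trans le_X.
  by rewrite (leq_trans (ltnW (ltn_expl j (ltnSn 1)))) // leq_pmull ?addn1.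
apply/hasP; exists q.
  rewrite mem_iota0 addnS ltnS; apply: leq_trans le_X.
  apply: leq_trans (leq_pmulr _ _); rewrite ?expn_gt0 //.
  apply: leq_trans (leq_addr _ _); apply: leq_trans (leq_pmulr _ _).
    by rewrite addn1 ltnW // ltnS leq_pmull.
  by rewrite expn_gt0.
by rewrite le_X -ltn_divLR ?expn_gt0 // def_q ltnSn.
Qed.

(* Prefixing [n] to a sequence turns the odd number [2 * code s + 1] into
   [1 + 2 ^ n.+1 * (2 * code s + 1)]: in binary, the terms of a sequence are
   the lengths of the blocks of zeros between consecutive ones. *)
Lemma code_memE s v : code_mem (CodeSeq.code s) v = (v \in s).
Proof.
set u := fun s => 2 * CodeSeq.code s + 1.
have u_cons n s' : u (n :: s') = u s' * 2 ^ n.+1 + 1 by rewrite /u /= expnS; nia.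
have pow_gt1 n : 1 < 2 ^ n.+1 by rewrite -{1}(expn0 2) ltn_exp2l.
have logn_odd a n : logn 2 ((2 * a + 1) * 2 ^ n) = n.
  rewrite lognM ?expn_gt0 ?addn1 // pfactorK // logn_coprime // coprime2n.
  by rewrite /= oddM.
apply/code_memP/idP; last first.
  elim: s => // n s IHs; rewrite inE => /predU1P[->|/IHs[j [q def_q]]].
    by exists 0, (CodeSeq.code s); rewrite divn1 -/(u (_ :: _)) u_cons.
  exists (n.+1 + j), q; rewrite -def_q -/(u (_ :: _)) u_cons expnD divnMA.
  by rewrite divnMDl ?expn_gt0 // [1 %/ _]divn_small ?addn0 ?pow_gt1 //.
elim: s => [|n s IHs] [j [q]]; rewrite -/(u _).
  have: 0 < 2 ^ v by rewrite expn_gt0.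
  have := leq_div (u [::]) (2 ^ j); rewrite expnS {2}/u /=; nia.
(* A shift [j > n] passes the head block and looks into the tail; [j = 0] reads the head as a 2-adic
   valuation; any other [j] leaves an even quotient, whereas the pattern is odd. *)
rewrite u_cons inE; have [lt_n|le_j] := ltnP n j.
  rewrite -(subnKC lt_n) expnD divnMA divnMDl ?expn_gt0 //.
  rewrite [1 %/ _]divn_small ?addn0 ?pow_gt1 // => def_q.
  by rewrite IHs ?orbT //; exists (j - n.+1), q.
case: j le_j => [_|j lt_j].
  rewrite divn1 => /addIn def_q; apply/orP; left; apply/eqP.
  by have := congr1 (logn 2) def_q; rewrite !logn_odd => -[->].
have ->: n.+1 = (n - j.+1).+1 + j.+1 by rewrite addSn subnK.
move/(congr1 odd); rewrite expnD mulnA.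
rewrite divnMDl ?expn_gt0 // [1 %/ _]divn_small ?pow_gt1 // addn0 addn1 /=.
by rewrite !oddM !oddX !andbF.
Qed.

Lemma data_code_mem s x : code_mem (data_code s) x.+1 = (Some x \in s).
Proof.
rewrite code_memE -[x.+1]/(symbol_code (Some x)) mem_map //.
by move=> [y|] [z|] // [->].
Qed.

(** The learner searches below the code of its data; this bound makes the search range grow with the
    text. *)
Lemma size_data_code s : size s <= data_code s.
Proof.
rewrite -(size_map symbol_code s) /data_code.
elim: (map _ _) => //= n t IHt; rewrite -muln2.
have : 0 < 2 ^ n by rewrite expn_gt0.
by nia.
Qed.

(** * Strictly increasing subsequences of chains *)

Lemma bounded_stage (P : nat -> nat -> bool) n :
  (forall s s' i, s <= s' -> P s i -> P s' i) ->
  (forall i, i < n -> exists s, P s i) -> exists s, forall i, i < n -> P s i.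
Proof.
move=> monoP; elim: n => [|n IHn] exP; first by exists 0.
have [|s sP] := IHn; first by move=> i lti; apply: exP; apply: ltnW.
have [s' s'P] := exP n (ltnSn n).
exists (maxn s s') => i; rewrite ltnS leq_eqVlt => /predU1P[->|/sP].
  by apply: monoP s'P; rewrite leq_maxr.
by apply: monoP; rewrite leq_maxl.
Qed.

Lemma count_ltn_iota p n : p <= n -> count (fun i => i < p) (iota 0 n) = p.
Proof.
move=> le_pn; rewrite -{1}(subnKC le_pn) iotaD count_cat add0n.
rewrite (_ : count _ (iota 0 p) = p); last first.
  rewrite -[RHS](size_iota 0); apply/eqP; rewrite -all_count.
  by apply/allP => i; rewrite mem_iota0.
rewrite (_ : count _ _ = 0) ?addn0 //; apply/eqP; rewrite -leqn0 leqNgt -has_count.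
by apply/hasPn => i; rewrite mem_iota -leqNgt => /andP[].
Qed.

Definition jumps (L : nat -> set nat) (n : nat) : nat :=
  count (fun i => `[< ~ L i.+1 `<=` L i >]) (iota 0 n).

(** For an increasing chain that never stabilizes, this is its last member with at most [k] jumps
    before it. The condition is an upper bound because jumps are counted from above: once an
    estimate is at most [k], so is the true count. *)
Definition block (L : nat -> set nat) (k : nat) : set nat :=
  \bigcup_(n in [set n | jumps L n <= k]) L n.

Lemma jumpsS L n : jumps L n.+1 = jumps L n + `[< ~ L n.+1 `<=` L n >].
Proof. by rewrite /jumps -[in LHS]addn1 iotaD count_cat /= addn0 add0n. Qed.

Lemma leq_jumps L n m : n <= m -> jumps L n <= jumps L m.
Proof. by move=> le_nm; rewrite /jumps -(subnKC le_nm) iotaD count_cat leq_addr. Qed.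

Lemma jumps_const L n m : n <= m -> jumps L m <= jumps L n -> L m `<=` L n.
Proof.
elim: m => [|m IHm]; first by rewrite leqn0 => /eqP-> _ x.
rewrite leq_eqVlt => /predU1P[-> _ x //|le_nm]; rewrite jumpsS => le_j.
have sub_mn : L m `<=` L n by apply: IHm => //; lia.
have le_mj : jumps L n <= jumps L m by apply: leq_jumps.
have /asboolPn/contrapT : ~~ `[< ~ L m.+1 `<=` L m >] by lia.
by move=> /subset_trans; apply.
Qed.

Lemma jumps_unbounded L k : (forall n, exists m, ~ L m `<=` L n) ->
  (forall n m, n <= m -> L n `<=` L m) -> exists n, k < jumps L n.
Proof.
move=> unstable mono.
have next n : exists m, jumps L n < jumps L m.
  have [m nLm] := unstable n; exists m; rewrite ltnNge; apply/negP => le_j.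
  apply: nLm; have [le_mn|/ltnW le_nm] := leqP m n; first exact: mono.
  exact: jumps_const.
elim: k => [|k [n lt_k]]; first by have [m] := next 0; exists m.
by have [m lt_j] := next n; exists m; apply: leq_trans lt_j.
Qed.

(** Since jumps are unbounded, there is a greatest [n] with at most [k] of them. The step after it
    is a jump, and the count grows by at most one per step, so it equals [k] at [n]. *)
Lemma block_mem L k : (forall n, exists m, ~ L m `<=` L n) ->
  (forall n m, n <= m -> L n `<=` L m) ->
  exists n, [/\ jumps L n = k, block L k = L n & ~ L n.+1 `<=` L n].
Proof.
move=> unstable mono.
have [N ltN] := jumps_unbounded k unstable mono.
have ex0 : exists n, jumps L n <= k by exists 0.
have bound n : jumps L n <= k -> n <= N.
  rewrite leqNgt => le_k; rewrite leqNgt; apply: contra le_k => /ltnW le_Nn.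
  exact: leq_trans ltN (leq_jumps L le_Nn).
case: (ex_maxnP ex0 bound) => n le_k max_n; exists n.
have : k < jumps L n.+1.
  by rewrite ltnNge; apply/negP => /max_n; rewrite ltnn.
rewrite jumpsS; case: asboolP => [jump_n|_] lt_k; last by lia.
split=> //; first by lia.
apply/seteqP; split=> [x [m /max_n/mono]|x Lx]; first exact.
by exists n.
Qed.

Lemma sub_block L k k' : k <= k' -> block L k `<=` block L k'.
Proof. by move=> le_k x [n jn Lx]; exists n => //; apply: leq_trans le_k. Qed.

Lemma block_inj L : (forall n, exists m, ~ L m `<=` L n) ->
  (forall n m, n <= m -> L n `<=` L m) -> injective (block L).
Proof.
move=> unstable mono.
suff lt_block k k' : k < k' -> block L k <> block L k'.
  by move=> k k' eq_b; have [/lt_block//|/lt_block//|//] := ltngtP k k'; case.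
move=> lt_k eq_b; have [n [jn bn jump_n]] := block_mem k unstable mono.
(* At most [k.+1] jumps precede [L n.+1], so it lies in block [k'], which is assumed equal to
   [L n]. *)
apply: jump_n; rewrite -bn eq_b => x Lx; apply: (sub_block lt_k).
by exists n.+1 => //=; rewrite jumpsS jn; case: `[< _ >] => /=; lia.
Qed.

(* A jump of the chain of closures is refuted at a finite stage, so the count
   of jumps decreases to its true value. *)
Lemma block_stages (eta : nat -> nat -> Prop) (a : nat -> nat -> bool)
    (e : nat -> nat -> nat -> bool) :
  Equivalence eta ->
  recs 2 (fun s => a (nth 0 s 0) (nth 0 s 1)) ->
  (forall s x, a s x -> x < s) ->
  recs 3 (fun s => e (nth 0 s 0) (nth 0 s 1) (nth 0 s 2)) ->
  (forall x y, eta x y <-> exists s, e s x y) ->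
  (forall s s' x y, s <= s' -> e s x y -> e s' x y) ->
  exists b : nat -> nat -> nat -> bool,
    recs 3 (fun s => b (nth 0 s 0) (nth 0 s 1) (nth 0 s 2)) /\
    forall k x, block (fun n => eta_closure eta [set y | a n y]) k x <->
                exists s, b s k x.
Proof.
move=> [refl_eta sym_eta trans_eta] reca a_lt rece eP mono_e.
set L := fun n => eta_closure eta [set y | a n y].
(* Confirms by stage [s] that step [n] is no jump: each element of [a n.+1] has been seen equivalent
   to one of [a n]. Steps not yet confirmed overcount the jumps. *)
pose stay s n := all (fun x => a n.+1 x ==>
  has (fun y => a n y && e s y x) (iota 0 n)) (iota 0 n.+1).
pose b s k x := has (fun n =>
    (count (fun i => ~~ stay s i) (iota 0 n) <= k) &&
    has (fun y => a n y && e s y x) (iota 0 n)) (iota 0 s).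
have LP n x : reflect (exists s, has (fun y => a n y && e s y x) (iota 0 n))
    `[< L n x >].
  apply: (iffP (asboolP _)) => [[y any /eP[s esyx]]|[s /hasP[y _ /andP[any es]]]].
    by exists s; apply/hasP; exists y; rewrite ?mem_iota0 ?a_lt ?any.
  by exists y => //; apply/eP; exists s.
have mono_has s s' n x : s <= s' -> has (fun y => a n y && e s y x) (iota 0 n) ->
    has (fun y => a n y && e s' y x) (iota 0 n).
  by move=> les; apply: sub_has => y /andP[-> /(mono_e _ _ _ _ les)].
have stayP n : (exists s, stay s n) <-> L n.+1 `<=` L n.
  split=> [[s /allP st] x [y any eta_yx]|sub].
    have:= st y; rewrite mem_iota0 a_lt // => /(_ isT)/implyP/(_ any) has_y.
    have /asboolP[z anz eta_zy] : `[< L n y >] by apply/LP; exists s.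
    by exists z => //; apply: trans_eta eta_zy eta_yx.
  have [s s' x les /implyP st|x _|s st] := @bounded_stage (fun s x =>
    a n.+1 x ==> has (fun y => a n y && e s y x) (iota 0 n)) n.+1.
  - by apply/implyP => /st; apply: mono_has.
  - have [anx|_] := boolP (a n.+1 x); last by exists 0.
    by apply/LP/asboolP/sub; exists x => //; apply: refl_eta.
  - by exists s; apply/allP => x; rewrite mem_iota0 => /st.
exists b; split.
  rewrite /b /stay.
  by repeat first [progress recs_auto | apply: (@recs_app2 _ (fun x y => a x y))
    | apply: (@recs_app3 _ (fun x y z => e x y z))].
move=> k x; split=> [[n jn /asboolP/LP[s1 has1]]|[s /hasP[n _ /andP[le_k has_n]]]].
  have [s2 st2] : exists s, forall i, i < n ->
      `[< L i.+1 `<=` L i >] ==> stay s i.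
    apply: bounded_stage => [s s' i les /implyP st|i _].
      apply/implyP => /st; apply: sub_all => y /implyP sty; apply/implyP.
      by move=> /sty; apply: mono_has.
    by case: asboolP => [/stayP[s st]|_]; [exists s|exists 0].
  (* The stage must exceed [n], witness [L n x] ([s1]) and confirm every non-jump below [n] ([s2]),
     which brings the estimate down to the true count. *)
  pose s := maxn n.+1 (maxn s1 s2); exists s; apply/hasP; exists n.
    by rewrite mem_iota0 leq_maxl.
  rewrite (mono_has _ _ _ _ _ has1) ?andbT; last by lia.
  apply: leq_trans jn; rewrite /jumps.
  rewrite (@eq_in_count _ _ (fun i => (i < n) && ~~ stay s i)); last first.
    by move=> i; rewrite mem_iota0 => ->.
  apply: sub_count => i /andP[lti]; apply: contraR => /asboolPn/contrapT sub_i.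
  have := st2 i lti; rewrite (asboolT sub_i) /=; apply: sub_all => y /implyP sty.
  by apply/implyP => /sty; apply: mono_has; lia.
exists n; last by apply/asboolP/LP; exists s.
apply: leq_trans le_k; apply: sub_count => i /asboolP nsub.
by apply/negP => st; apply: nsub; apply/stayP; exists s.
Qed.

(** * The learner *)

Lemma chain_learnable (W : nat -> set nat) (eta : nat -> nat -> Prop)
    (a : nat -> nat -> bool) (x0 : nat) (C : set (set nat)) :
  acceptable W -> Equivalence eta ->
  recs 2 (fun s => a (nth 0 s 0) (nth 0 s 1)) ->
  (forall s s' x, s <= s' -> a s x -> a s' x) ->
  (forall s x, a s x -> x < s) ->
  (forall L, C L -> L = setT \/
     [/\ ~ L x0, exists n, L = eta_closure eta [set y | a n y]
       & exists n x, a n x /\ ~ L x]) ->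
  explanatorily_learnable W eta C.
Proof.
move=> [_ W_acc] [refl_eta _ trans_eta] reca mono_a a_lt CP.
(* [f 0] is an index of the set of all numbers, [f n.+1] one of stage [n]. *)
have [|f recf fP] := W_acc (fun k => [set x | (k == 0) || a k.-1 x]).
  apply: (@re_rel_of_stages _ (fun _ k x => (k == 0) || a k.-1 x)).
    by repeat first [progress recs_auto | apply: (@recs_app2 _ (fun x y => a x y))].
  by move=> k x; split=> [akx|[]//]; exists 0.
(* Stages increase, so the [n] counted form an initial segment, and the count is the last stage up
   to [m] whose elements have all occurred. *)
pose guess m := count (fun n => all (fun x => a n.+1 x ==> code_mem m x.+1)
  (iota 0 n.+1)) (iota 0 m).
pose h m := if code_mem m x0.+1 then f 0 else f (guess m).+1.
exists (fun s => Some (h (data_code s))).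
  exists (fun m => (h m).+1) => //; apply: recs_recursive_fun; apply: recs_succ.
  apply: recs_if.
  - by apply: (@recs_app2 _ (fun x y => code_mem x y)); recs_auto;
      apply: recs_code_mem.
  - by apply: recs_app1 => //; recs_auto.
  - apply: recs_app1 => //; rewrite /guess.
    by repeat first [progress recs_auto | exact: recs_code_mem
      | apply: (@recs_app2 _ (fun x y => a x y))
      | apply: (@recs_app2 _ (fun x y => code_mem x y))].
move=> L T CL textT.
have dataT n x : Some x \in mkseq T n -> L x.
  by case/mapP => i _ Ti; rewrite -textT; exists i.
have mono_data n n' x : n <= n' -> Some x \in mkseq T n -> Some x \in mkseq T n'.
  move=> len /mapP[i]; rewrite mem_iota0 => lti ->.
  by rewrite map_f // mem_iota0 (leq_trans lti).
have data_ex x : L x -> exists n, Some x \in mkseq T n.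
  rewrite -textT => -[i Ti]; exists i.+1; apply/mapP; exists i => //.
  by rewrite mem_iota0.
have [defL|[nLx0 [n0 defL] [n1 [x1 [an1 nLx1]]]]] := CP L CL.
  exists (f 0).
    have [N x0N] : exists n, Some x0 \in mkseq T n by apply: data_ex; rewrite defL.
    exists N => n leN; rewrite /h data_code_mem.
    by rewrite (mono_data N n).
  rewrite -fP defL; apply/seteqP; split=> // x _.
  by exists x; [|apply: refl_eta].
have ex_out : exists n, `[< exists x, a n x /\ ~ L x >].
  by exists n1; apply/asboolP; exists x1.
(* Stage 0 is empty, so the least stage leaving [L] is some [p.+1], and stage [p] is the last one
   inside [L]. *)
case: (ex_minnP ex_out) => -[|p] /asboolP[x2 [ax2 nLx2]] min_p.
  by have := a_lt _ _ ax2.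
have sub_p x : a p x -> L x.
  move=> apx; apply: contrapT => nLx; have : p < p; last by rewrite ltnn.
  by apply: min_p; apply/asboolP; exists x.
exists (f p.+1); last first.
  rewrite -fP /=; apply/seteqP; split=> x.
    move=> [y /sub_p]; rewrite defL => -[z an0 eta_zy] eta_yx.
    by exists z => //; apply: trans_eta eta_zy eta_yx.
  rewrite defL => -[y an0 eta_yx]; exists y => //=.
  (* Otherwise stage [p.+1] would be part of stage [n0], which generates [L]. *)
  have: n0 <= p.
    rewrite leqNgt; apply/negP => lt_p; apply: nLx2; rewrite defL.
    by exists x2; [apply: mono_a lt_p ax2|apply: refl_eta].
  by move=> /mono_a; apply.
have [s s' x les /implyP st|x _|N dataN] := @bounded_stage (fun s x =>
    a p x ==> (Some x \in mkseq T s)) p.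
- by apply/implyP => /st; apply: mono_data.
- have [/sub_p/data_ex[n xn]|_] := boolP (a p x); last by exists 0.
  by exists n.
(* Length at least [p] lets the bounded count reach [p]; from [N] on, all of stage [p] has been
   seen. *)
exists (maxn p N) => n; rewrite geq_max => /andP[le_pn leNn].
rewrite /h data_code_mem ifN; last by apply/negP => /dataT.
rewrite /guess (@eq_in_count _ _ (fun i => i < p)) ?count_ltn_iota //.
  apply: leq_trans (size_data_code _); by rewrite size_mkseq.
move=> i _; apply/allP/idP => [all_i|lt_ip x _].
  rewrite ltnNge; apply/negP => le_pi; apply: nLx2; apply: (dataT n).
  have aix2 : a i.+1 x2 by apply: mono_a ax2.
  have := all_i x2; rewrite mem_iota0 a_lt // data_code_mem => /(_ isT)/implyP.
  exact.
apply/implyP => /(mono_a _ _ _ lt_ip) apx; rewrite data_code_mem.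
by apply: mono_data leNn _; apply: (implyP (dataN x (a_lt _ _ apx))).
Qed.

(** * Failure of weak confidence *)

Lemma not_weakly_confidently_learnable (W : nat -> set nat)
    (eta : nat -> nat -> Prop) (B : nat -> set nat) (U : set nat)
    (C : set (set nat)) :
  injective B -> (forall k, B k `<=` B k.+1) -> (forall k, C (B k)) ->
  C U -> (forall k, B k `<=` U) -> ~ weakly_confidently_learnable W eta C.
Proof.
move=> injB subB CB CU subU [M _ [learns conf]].
pose within k (s : seq (option nat)) := forall x, Some x \in s -> B k x.
(* The premise [within] sits under the existential so that choice applies to all pairs. *)
have extend (p : nat * seq (option nat)) : exists s, within p.1 p.2 ->
    [/\ within p.1 s, size p.2 < size s, take (size p.2) s = p.2
      & exists2 e, M s = Some e & eta_closure eta (W e) = B p.1].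
  case: p => k s /=; have [in_s|nin_s] := asboolP (within k s); last first.
    by exists [::] => /nin_s.
  (* Continues [s] to a text for [B k]: position [size s + x] presents [x] or pauses. *)
  pose T n := if n < size s then nth None s n
    else if `[< B k (n - size s) >] then Some (n - size s) else None.
  have T_B n x : T n = Some x -> B k x.
    rewrite /T; case: ltnP => [lt_n Tx|_]; first by apply: in_s; rewrite -Tx mem_nth.
    by case: asboolP => // Bx [<-].
  have textT : is_text T (B k).
    apply/seteqP; split=> [x [n /T_B]//|x Bx]; exists (size s + x).
    by rewrite /T ltnNge leq_addr /= addKn asboolT.
  have [e [N convN] We] := learns _ _ (CB k) textT.
  exists (mkseq T (maxn N (size s).+1)) => _; split.
  - by move=> x /mapP[n _ /esym/T_B].
  - by rewrite size_mkseq leq_maxr.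
  - apply: (@eq_from_nth _ None) => [|i].
      by rewrite size_takel // size_mkseq ltnW // leq_maxr.
    rewrite size_takel ?size_mkseq; last by lia.
    by move=> lti; rewrite nth_take // nth_mkseq ?/T ?lti //; lia.
  - by exists e => //; apply: convN; rewrite leq_maxl.
have [F FP] := choice extend.
(* [sig k.+1] prolongs [sig k] by data from [B k] until [M] outputs a hypothesis for [B k]. *)
pose sig := fix sig k := if k is k'.+1 then F (k', sig k') else [::].
have sig_in k : within k (sig k).
  elim: k => // k /(FP (k, _))[/= in_s _ _ _] x /in_s; exact: subB.
have sigS k := FP (k, sig k) (sig_in k).
have size_sig k : k <= size (sig k).
  by elim: k => // k IHk; have [_ lt_s _ _] := sigS k; apply: leq_trans lt_s.
have nth_sig k k' n : k <= k' -> n < size (sig k) ->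
    nth None (sig k') n = nth None (sig k) n.
  move=> /subnKC <- lt_n.
  suff [] : n < size (sig (k + (k' - k))) /\
            nth None (sig (k + (k' - k))) n = nth None (sig k) n by [].
  elim: (k' - k) => [|d [lt_d <-]]; first by rewrite addn0.
  rewrite addnS; have [/= _ lt_sig take_sig _] := sigS (k + d).
  split; first exact: ltn_trans lt_d lt_sig.
  by rewrite -[in RHS]take_sig nth_take.
pose T n := nth None (sig n.+1) n.
have sigT k : sig k = mkseq T (size (sig k)).
  apply: (@eq_from_nth _ None) => [|n lt_n]; first by rewrite size_mkseq.
  rewrite nth_mkseq // /T; have [le_k|lt_k] := leqP k n.+1.
    by rewrite (nth_sig k).
  by rewrite (nth_sig n.+1) // ltnW.
have [|o [N convN]] := conf T.
  exists U => // x [n Tn]; apply: (subU n.+1); apply: sig_in.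
  by rewrite -Tn /T mem_nth.
(* The prefix [sig k.+1] is longer than [N], so the output on it is already the limit, and it
   describes [B k]. *)
have out k : N <= k -> exists2 e, o = Some e & eta_closure eta (W e) = B k.
  move=> leN; have [_ lt_s _ [e Me We]] := sigS k; exists e => //.
  rewrite -Me -[F _]/(sig k.+1) sigT convN //.
  by apply: leq_trans (size_sig _); apply: leqW.
have [e oe BN] := out N (leqnn N); have [e' oe' BN'] := out N.+1 (leqnSn N).
have /injB/eqP : B N = B N.+1 by rewrite -BN -BN'; move: oe'; rewrite oe => -[->].
by rewrite ltn_eqF.
Qed.

(** * The family: a chain of closures and the set of all numbers *)

Theorem theorem14 (W : nat -> set nat) (W_acceptable : acceptable W)
    (eta : nat -> nat -> Prop) (eta_positive : positive_equivalence eta)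
    (two_infinite : exists A B : set nat,
       [/\ re_set A, re_set B, eta_infinite eta A, eta_infinite eta B
         & A <> B]) :
  exists C : set (set nat),
    [/\ eta_family eta C, explanatorily_learnable W eta C
      & ~ weakly_confidently_learnable W eta C].
Proof.
have [eqv_eta re_eta _] := eta_positive.
have [refl_eta sym_eta trans_eta] := eqv_eta.
(* Two different sets cannot both contain every number. *)
have [A [reA infA [x0 nAx0]]] : exists A : set nat,
    [/\ re_set A, eta_infinite eta A & exists x, ~ A x].
  have [A [B [reA reB infA infB neqAB]]] := two_infinite.
  have [[x nAx]|allA] := pselect (exists x, ~ A x).
    by exists A; split=> //; exists x.
  exists B; split=> //; apply: contrapT => allB; apply: neqAB.
  by apply/seteqP; split=> x _; apply: contrapT => nx;
    [apply: allB|apply: allA]; exists x.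
have [a [reca aP mono_a a_lt]] := re_set_stages reA.
have [e [rece eP mono_e]] := re_rel_stages re_eta.
pose L n := eta_closure eta [set y | a n y].
have mono_L n m : n <= m -> L n `<=` L m.
  by move=> le_nm x [y any eta_yx]; exists y => //; apply: mono_a any.
have [X [subX infX defA]] := infA.
have closedA x y : A x -> eta x y -> A y.
  rewrite defA => -[K XK Kx] eta_xy; exists K => //.
  have [z _ defK] := subX K XK; rewrite -defK in Kx *.
  exact: trans_eta Kx eta_xy.
have unstable n : exists m, ~ L m `<=` L n.
  (* If [L n] absorbed all later stages, every class in [A] would be that of a number below [n],
     leaving finitely many classes. *)
  apply: contrapT => stable; apply: infX.
  apply: (@sub_finite_set _ _ (eclass eta @` `I_n)); last first.
    by apply: finite_image; apply: finite_II.
  move=> K XK; have [z _ defK] := subX K XK.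
  have [s asz] : exists s, a s z.
    by apply/aP; rewrite defA; exists K => //; rewrite -defK; apply: refl_eta.
  have [y any eta_yz] : L n z.
    apply: contrapT => nLz; apply: stable; exists s => sub; apply: nLz.
    by apply: sub; exists z => //; apply: refl_eta.
  exists y; first exact: a_lt any.
  rewrite -defK; apply/seteqP; split=> w.
    exact: trans_eta (sym_eta _ _ eta_yz).
  exact: trans_eta eta_yz.
have not_L n : ~ L n x0.
  by move=> [y any eta_yx]; apply: nAx0; apply: closedA eta_yx; apply/aP; exists n.
(* Index 0 is taken by the set of all numbers, which differs from every block because no [L n]
   contains [x0]. *)
pose D k := if k is k'.+1 then block L k' else setT.
have D_L k : exists n, D k.+1 = L n /\ ~ L n.+1 `<=` L n.
  by have [n [_ Bn nsub]] := block_mem k unstable mono_L; exists n.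
have injD : injective D.
  suff neqT k : block L k <> setT.
    move=> [|k] [|k'] //=; first by move=> /esym/neqT.
      by move=> /neqT.
    by move=> /(block_inj unstable mono_L) ->.
  move=> eqT; have [n [defL _]] := D_L k; apply: (not_L n).
  by rewrite -defL /= eqT.
have [b [recb bP]] := block_stages eqv_eta reca a_lt rece eP mono_e.
exists (range D); split.
- split.
  + have := inj_card_eq (in2W injD : {in setT &, injective D}).
    by rewrite card_eq_le => /andP[_ /infiniteP].
  + move=> _ [[|k] _ <-].
      exists (eclasses eta) => //; apply/seteqP; split=> // x _.
      by exists (eclass eta x); [exists x|apply: refl_eta].
    have [n [-> _]] := D_L k.
    exists (eclass eta @` [set y | a n y]); first by move=> _ [y _ <-]; exists y.
    by rewrite bigcup_image.
  exists D; split=> //.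
  apply: (@re_rel_of_stages _ (fun s k x => (k == 0) || b s k.-1 x)).
    by repeat first [progress recs_auto
      | apply: (@recs_app3 _ (fun x y z => b x y z))].
  move=> [|k] x; first by split=> // _; exists 0.
  exact: bP.
- apply: (@chain_learnable _ _ a x0) => //; move=> _ [[|k] _ <-]; [by left|right].
  have [n [-> nsub]] := D_L k; split=> //; first by exists n.
  (* At a jump some element of [a n.+1] lies outside [L n]; otherwise [L n] would contain the
     closure of that stage. *)
  apply: contrapT => none; apply: nsub => y [x anx eta_xy].
  have [z anz eta_zx] : L n x.
    by apply: contrapT => nLx; apply: none; exists n.+1, x.
  by exists z => //; apply: trans_eta eta_zx eta_xy.
- apply: (@not_weakly_confidently_learnable _ _ (block L) setT) => //.
  + exact: block_inj.
  + by move=> k; apply: sub_block.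
  + by move=> k; exists k.+1.
  + by exists 0.
Qed.
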